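(* Let $n$ be the number of vertices and $k$ the number of players, and let $\alpha$ satisfy $\alpha=\Omega(\log n)$ and $\alpha=o(\min\{n/k,k\})$. Then any simultaneous protocol that, in the random partition model, outputs an $\alpha$-approximate minimum vertex cover with success probability at least $0.9$ has communication cost $\Omega(nk/\alpha)$ bits.
   Context: Multi-party simultaneous communication model: the input graph $G$ on $n$ vertices is partitioned among $k$ players $P^{(1)},\dots,P^{(k)}$, who share public randomness; each player simultaneously sends one message to a coordinator, who then must output the answer based only on the messages. The communication cost is the total number of bits sent. In the random partition model the edge set of $G$ is partitioned by assigning each edge independently to a player chosen uniformly at random. An $\alpha$-approximate vertex cover is a vertex cover of $G$ of size at most $\alpha\cdot\mathrm{VC}(G)$, where $\mathrm{VC}(G)$ is the minimum vertex cover size. *)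

(* Defs.v *)
From mathcomp Require Export all_boot all_order all_algebra.
From mathcomp Require Export all_classical all_reals all_analysis.
Export Order.TTheory GRing.Theory Num.Theory numFieldNormedType.Exports.

Set Implicit Arguments.
Unset Strict Implicit.
Unset Printing Implicit Defensive.

Local Open Scope classical_set_scope.
Local Open Scope ring_scope.

Definition edge (n : nat) : finType := {e : {set 'I_n} | #|e| == 2%N}.

(** A simple graph on the vertex set ['I_n] is given by its edge set. *)
Definition graph (n : nat) := {set edge n}.

Definition vertex_cover n (G : graph n) (C : {set 'I_n}) : bool :=
  [forall e in G, exists v in val e, v \in C].

(** The minimum vertex cover size; [setT] is always a vertex cover. *)
Definition VC n (G : graph n) : nat :=
  #|[arg min_(C < [set: 'I_n]%SET | vertex_cover G C) #|C|]|.

Definition approx_vertex_cover (R : realType) n (alpha : R) (G : graph n)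
    (C : {set 'I_n}) : bool :=
  vertex_cover G C && (#|C|%:R <= alpha * (VC G)%:R).

(** [sigma] sends every potential edge to a player, and player [i] receives
    the edges of [G] sent to [i].  For [sigma] uniform, the players of the edges
    of [G] are independent and uniform; the values of [sigma] outside [G] are
    not used. *)
Definition assignment (n k : nat) := {ffun edge n -> 'I_k}.

Definition part n k (G : graph n) (sigma : assignment n k) (i : 'I_k) :
  {set edge n} := [set e in G | sigma e == i]%SET.

(** The public coins are a point of an arbitrary probability space.  They are
    visible to the coordinator too, who sees the input only through the
    messages; coordinators that ignore the coins are a particular case.
    Private randomness of any party can be included in the coins. *)
Record protocol (R : realType) (n k : nat) := Protocol {
  coins_display : measure_display;
  coins : measurableType coins_display;
  coins_prob : probability coins R;
  message : 'I_k -> coins -> {set edge n} -> seq bool;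
  output : coins -> {ffun 'I_k -> seq bool} -> {set 'I_n};
  measurable_message : forall i E m,
    measurable [set w | message i w E = m];
  measurable_output : forall ms C,
    measurable [set w | output w ms = C] }.

Section protocol_theory.
Variables (R : realType) (n k : nat) (Pi : protocol R n k).

Definition transcript (w : coins Pi) (G : graph n) (sigma : assignment n k) :
    {ffun 'I_k -> seq bool} :=
  [ffun i => message i w (part G sigma i)].

Definition answer (w : coins Pi) (G : graph n) (sigma : assignment n k) :
    {set 'I_n} :=
  output w (transcript w G sigma).

(** The worst case of the total number of bits sent, over the coins, the input
    graph and its partition; it is [+oo] if this number is not bounded. *)
Definition communication_cost : \bar R :=
  ereal_sup [set c | exists w G sigma,
    c = ((\sum_(i < k) size (transcript w G sigma i))%N%:R)%:E].

(** The probability is over the coins and over an independent uniform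
    assignment. *)
Definition success_probability (alpha : R) (G : graph n) : R :=
  (\sum_(sigma : assignment n k)
     fine (coins_prob Pi
       [set w | approx_vertex_cover alpha G (answer w G sigma)]))
  / #|{: assignment n k}|%:R.

Definition solves_vertex_cover (alpha p : R) : Prop :=
  forall G : graph n, p <= success_probability alpha G.

End protocol_theory.

(* Main.v *)
Require Import Defs.
From mathcomp Require Import measurable_realfun ring lra zify.

(** Fix disjoint vertex blocks of sizes [h ~ n/3] and [h + s] with [s = k/2],
    and give every left vertex [u] the [s] slots [{u, h+u+j}].  Choose a random
    set [D] of about [n/(20 alpha)] left vertices and a random [u] in [D], keep
    each slot of [D \ u] with probability [1/2], and plant one random slot [e] of [u].
    [D] is a vertex cover, so an [alpha]-approximate cover has at most
    [alpha #|D| ~ n/20] vertices, yet it must meet [e].  Without [e] the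
    transcript depends on [D \ u] only and such a small answer meets the random
    [e] with small probability.  So the messages have to reveal [e].

    With probability at least [1/2] no other slot of [u] belongs to the player
    [i] who owns [e].  The planted graph and the graph without [e] then differ
    for player [i] only, in one of about [#|D|] (over all [i], at most [s #|D|])
    independent fair bits of the random subgraph of the slots of [D].  A message
    of [b] bits about independent fair bits can correlate with them by at most
    [O(b / lambda + lambda #bits)] in total, by an exponential moment argument;
    summing over the players bounds the total advantage by
    [O(L / (s #|D|))] up to small terms, [L] being the cost. *)

Set Implicit Arguments.
Unset Strict Implicit.
Unset Printing Implicit Defensive.

Local Open Scope ring_scope.

(** * Correlation of a short message with fair bits *)

Section Toggle.
Variables (R : realType) (E : finType).
Implicit Types (e : E) (g B : {set E}).

Definition sgn_in e g : R := if e \in g then 1 else -1.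

(** Up to order, [e |: g] and [g :\ e] are [g] and its image under the involution toggling [e], so
    every set is counted twice. *)
Lemma sum_toggle e (f : {set E} -> R) :
  \sum_g (f (e |: g)%SET + f (g :\ e)%SET) = (\sum_g f g) *+ 2.
Proof.
pose t g := (if e \in g then g :\ e else e |: g)%SET.
have tK : involutive t.
  move=> g; rewrite /t; case: (boolP (e \in g)) => eg; rewrite !inE eqxx /=.
    by rewrite finset.setD1K.
  by rewrite finset.setU1K.
have tf g : f (e |: g)%SET + f (g :\ e)%SET = f g + f (t g).
  rewrite /t; case: ifPn => eg; first by rewrite (finset.setUidPr _) ?finset.sub1set.
  by rewrite addrC (finset.setDidPl _) // disjoint_sym finset.disjoints1 eg.
rewrite (eq_bigr _ (fun g _ => tf g)) big_split /= mulr2n; congr (_ + _).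
by rewrite [RHS](reindex_inj (inv_inj tK)).
Qed.

(** Induction on [B]: no coefficient depends on whether [e \in B] lies in [g], so toggling [e] only
    flips the sign in its own factor, and [(1 + a) + (1 - a) = 2]. *)
Lemma sum_prod_sgn_in B (a : E -> {set E} -> R) :
    (forall e g, a e g = a e (g :\: B)%SET) ->
  \sum_g \prod_(e in B) (1 + sgn_in e g * a e g) = #|{set E}|%:R.
Proof.
have [n] := ubnP #|B|; elim: n => // n IHn in B * => /ltnSE Bn aB.
have [->|[e eB]] := finset.set_0Vmem B.
  by rewrite (eq_bigr (fun _ => 1)) ?sumr_const// => g _; rewrite finset.big_set0.
rewrite -(IHn (B :\ e)%SET); last 2 first.
- by rewrite (cardsD1 e) eB in Bn.
- move=> e' g; rewrite aB [RHS]aB; congr (a _ _); apply/setP => x.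
  by rewrite !inE; case: (x \in B); rewrite ?andbF//= andbT.
apply: (@mulIf _ 2) => //; rewrite !mulr_natr -(@sum_toggle e) -sumrMnl.
apply: eq_bigr => g _.
have aU e' : a e' (e |: g)%SET = a e' g.
  rewrite aB [RHS]aB; congr (a _ _); apply/setP => x; rewrite !inE.
  by case: eqP => [->|//]; rewrite eB.
have aD e' : a e' (g :\ e)%SET = a e' g.
  rewrite aB [RHS]aB; congr (a _ _); apply/setP => x; rewrite !inE.
  by case: eqP => [->|//]; rewrite eB.
rewrite !(finset.big_setD1 e eB) /= aU aD.
under eq_bigr => e' /[!inE] /andP[/negPf ne' _] do rewrite aU /sgn_in !inE ne' /=.
under [X in _ * _ + _ * X]eq_bigr => e' /[!inE] /andP[ne' _]
  do rewrite aD /sgn_in !inE ne' /=.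
by rewrite /sgn_in !inE eqxx /=; ring.
Qed.

End Toggle.

(** * Kraft weights and an exponential inequality *)

Section Kraft.
Variable R : realType.

(** The [2 ^ l] messages of length [l] together weigh at most [2 ^- l], a geometric series. *)
Lemma sum_seqs_le (f : seq bool -> R) N :
    (forall m, f m <= 4^-1 ^+ size m) ->
  \sum_(l < N) \sum_(m : l.-tuple bool) f m <= 2.
Proof.
(* The induction carries the exact partial sum of the geometric series. *)
move=> f4; apply: le_trans (_ : 2 - 2^-1 ^+ N * 2 <= 2); last first.
  by rewrite gerBl mulr_ge0// exprn_ge0// invr_ge0.
elim: N => [|N IHN]; first by rewrite big_ord0 expr0 mul1r subrr.
rewrite big_ord_recr /=.
have : \sum_(m : N.-tuple bool) f m <= 2^-1 ^+ N.
  apply: le_trans (_ : \sum_(m : N.-tuple bool) 4^-1 ^+ N <= _).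
    by apply: ler_sum => m _; rewrite (le_trans (f4 m))// size_tuple.
  rewrite sumr_const card_tuple card_bool -[leLHS]mulr_natl natrX -exprMn.
  by rewrite (_ : 2%:R * 4^-1 = 2^-1)//; lra.
by rewrite exprS; lra.
Qed.

(** Since [exp(2y^2 - y) >= 1 - y + 2y^2], it is enough that
    [(1 + y)(1 - y + 2y^2) = 1 + y^2(1 + 2y)] is at least 1, which is where [y >= -1/2] enters. *)
Lemma expR_le1D (y : R) : - (1 / 2) <= y -> expR (y - 2 * y ^+ 2) <= 1 + y.
Proof.
move=> y2; rewrite -[leRHS]mul1r -ler_pdivrMr; last by lra.
rewrite -[leRHS](expRxMexpNx_1 (y - 2 * y ^+ 2)) ler_pM2l ?expR_gt0//.
apply: le_trans (expR_ge1Dx _); rewrite -[_^-1]mul1r ler_pdivrMr; last by lra.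
nra.
Qed.

Lemma expRN2_le (l : nat) : expR (- (2 * l%:R)) <= 4^-1 ^+ l :> R.
Proof.
rewrite (_ : - (2 * l%:R) = l%:R * (- 2)) ?expRM_natl; last by ring.
  apply: lerXn2r; rewrite ?nnegrE ?expR_ge0 ?invr_ge0//.
rewrite expRN lef_pV2 ?posrE ?expR_gt0// -[leRHS]/(expR 2%:R) -[2%:R]mulr1 expRM_natl.
have := expR_ge1Dx (1 : R); nra.
Qed.
End Kraft.

Section Correlation.
Variables (R : realType) (E : finType) (B : {set E}) (M : {set E} -> seq bool).
Variables (F : E -> seq bool -> {set E} -> R) (lambda : R).
Hypotheses (lambda_gt0 : 0 < lambda) (lambda_le : lambda <= 1 / 2).
Hypothesis F01 : forall e m g, 0 <= F e m g <= 1.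
Hypothesis FB : forall e m g, F e m g = F e m (g :\: B)%SET.

(* For a fixed message [m], the product of the [1 + sgn e * lambda * F e m]
   over [B] has mean 1 ([sum_prod_sgn_in]), while the Kraft weights
   [4 ^- size m] pay for the dependence of the message on [g]. *)
Lemma sum_sgn_in_message_le :
  lambda * \sum_g \sum_(e in B) sgn_in R e g * F e (M g) g <=
  \sum_(g : {set E}) (2 * lambda ^+ 2 * #|B|%:R + 2 * (size (M g))%:R + 1).
Proof.
pose W m g := \prod_(e in B) (1 + sgn_in R e g * (lambda * F e m g)).
have sgnB e g m : - (1 / 2) <= sgn_in R e g * (lambda * F e m g).
  have /andP[F0 F1] := F01 e m g.
  rewrite /sgn_in; case: ifP => _; last first.
    by rewrite mulN1r lerN2 (le_trans _ lambda_le)// ler_piMr// ltW.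
  by rewrite mul1r (@le_trans _ _ 0) ?mulr_ge0 ?(ltW lambda_gt0)// oppr_le0.
have W0 m g : 0 <= W m g.
  apply: prodr_ge0 => e _; rewrite -lerBlDl sub0r (le_trans _ (sgnB e g m))//.
  by rewrite lerN2; lra.
pose N := (\max_(g : {set E}) size (M g)).+1.
(* Bounding the term of [M g] by the sum over all messages [m] of length below [N] makes [m]
   independent of [g], so that each product has mean 1. *)
have sumW : \sum_(g : {set E}) 4^-1 ^+ size (M g) * W (M g) g
    <= 2 * #|{set E}|%:R.
  apply: le_trans (_ : \sum_(g : {set E}) \sum_(l < N) \sum_(m : l.-tuple bool)
     4^-1 ^+ size m * W m g <= _).
    apply: ler_sum => g _; rewrite /=.
    have lN : (size (M g) < N)%N by rewrite ltnS; apply: leq_bigmax.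
    have t0 (l : nat) (m : l.-tuple bool) : 0 <= 4^-1 ^+ size m * W m g :> R.
      by rewrite mulr_ge0// exprn_ge0// invr_ge0.
    rewrite (bigD1 (Ordinal lN))//= (bigD1 (in_tuple (M g)))//= -addrA lerDl.
    by rewrite addr_ge0// sumr_ge0// => l _; rewrite sumr_ge0.
  rewrite exchange_big /=; under eq_bigr do rewrite exchange_big /=.
  under eq_bigr => l _.
    under eq_bigr => m _.
      rewrite -mulr_sumr sum_prod_sgn_in; last by move=> e g; rewrite FB.
      over.
    rewrite -mulr_suml; over.
  rewrite -mulr_suml ler_wpM2r//.
  exact: (@sum_seqs_le R (fun m => 4^-1 ^+ size m)).
(* Each summand [1 + x] is at most [exp x], hence at most the Kraft weight times the product. The
   average of [x] is then at most [2 - 1], the final [1] of the bound. *)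
have : \sum_(g : {set E}) (1 + (lambda * (\sum_(e in B) sgn_in R e g * F e (M g) g)
     - 2 * lambda ^+ 2 * #|B|%:R - 2 * (size (M g))%:R)) <= 2 * #|{set E}|%:R.
  apply: le_trans sumW; apply: ler_sum => g _.
  apply: le_trans (expR_ge1Dx _) _; rewrite expRD mulrC ler_pM ?expR_ge0//.
    exact: expRN2_le.
  apply: le_trans (_ : \prod_(e in B) expR (sgn_in R e g * (lambda * F e (M g) g)
      - 2 * (sgn_in R e g * (lambda * F e (M g) g)) ^+ 2) <= _); last first.
    by apply: ler_prod => e _; rewrite expR_ge0/= expR_le1D.
  rewrite -expR_sum ler_expR sumrB mulr_sumr.
  rewrite lerB//; first by apply: ler_sum => e _; rewrite mulrCA.
  rewrite -mulr_sumr -mulrA ler_pM2l// mulr_natr -sumr_const ler_sum// => e _.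
  have := F01 e (M g) g; rewrite /sgn_in; case: ifP => _ /andP[F0 F1].
    by rewrite mul1r exprMn ler_piMr ?sqr_ge0// exprn_ile1.
  by rewrite mulN1r sqrrN exprMn ler_piMr ?sqr_ge0// exprn_ile1.
rewrite (_ : 2 * #|_|%:R = \sum_(g : {set E}) 2); last first.
  by rewrite sumr_const -[RHS]mulr_natr.
rewrite -subr_le0 -sumrB => H.
rewrite mulr_sumr -subr_le0 -sumrB; apply: le_trans H.
by apply: ler_sum => g _; lra.
Qed.

End Correlation.

(** * Removing the planted edge *)

Section Swap.
Variables (R : realType) (V J : finType) (k : nat).
Local Notation E := (V * J)%type.
Variables (msg : 'I_k -> {set E} -> seq bool).
Variable hit : E -> {ffun 'I_k -> seq bool} -> bool.
Implicit Types (c : E -> 'I_k) (D : {set V}) (e : E) (g T : {set E}).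

(** A slot is a pair of a left vertex and an index; its colour is the player who receives it. *)
Definition colored c T i : {set E} := [set e in T | c e == i].
Definition messages c T : {ffun 'I_k -> seq bool} :=
  [ffun i => msg i (colored c T i)].
Definition over D g : {set E} := [set e in g | e.1 \in D].
Definition uniquely_colored c e := [forall j, (c (e.1, j) == c e) ==> (j == e.2)].

Lemma uniquely_coloredP c e x :
  uniquely_colored c e -> x.1 = e.1 -> c x = c e -> x = e.
Proof.
case: x => u j /forallP/(_ j) /= + ue; rewrite ue => /implyP cj cx.
by move: cj; rewrite cx eqxx => /(_ isT)/eqP ->; case: (e).
Qed.

Variables (c : E -> 'I_k) (D : {set V}) (L lambda : R).
Hypotheses (lambda_gt0 : 0 < lambda) (lambda_le : lambda <= 1 / 2).
Hypothesis cost_le : forall g, (\sum_i size (messages c g i))%:R <= L.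

Let hits1 e g : R := (hit e (messages c (e |: over (D :\ e.1) g)%SET))%:R.
Let hits0 e g : R := (hit e (messages c (over (D :\ e.1) g)%SET))%:R.

(** As [e] is the only slot of its left vertex with colour [i], player [i] cannot tell the planted
    graph from [over D (e |: g)], nor the graph without [e] from [over D (g :\ e)]. The other
    players never see [e]. The difference of the hits is thus a correlation of the message of [i]
    with the bit [e \in g]. *)
Lemma sum_swap_color_le i :
  lambda * \sum_(e | [&& e.1 \in D, uniquely_colored c e & c e == i])
     \sum_g (hits1 e g - hits0 e g) <=
  2 * \sum_(g : {set E}) (2 * lambda ^+ 2 *
      #|[set e | [&& e.1 \in D, uniquely_colored c e & c e == i]]|%:R
    + 2 * (size (messages c (over D g) i))%:R + 1).
Proof.
set B := [set e | _]; pose M g := messages c (over D g) i.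
(* [F] reads [g] through the messages of the other players only, so it does
   not depend on the edges of colour [i], in particular not on [B]. *)
pose F e m g : R := (hit e [ffun j => if j == i then m
   else messages c (over (D :\ e.1) g) j])%:R.
have F01 e m g : 0 <= F e m g <= 1 by rewrite /F; case: hit; rewrite ?lexx ler01.
have FB e m g : F e m g = F e m (g :\: B)%SET.
  rewrite /F; congr ((hit e _)%:R); apply/ffunP => j; rewrite !ffunE.
  case: eqP => // /eqP ji; congr (msg j _); apply/setP => x; rewrite !inE.
  by case: (eqVneq (c x) j) => [->|_]; rewrite ?andbF// (negPf ji) !andbF.
have := sum_sgn_in_message_le M lambda_gt0 lambda_le F01 FB.
rewrite -(ler_pM2l (ltr0n R 2)); apply: le_trans.
rewrite [leRHS]mulrCA ler_pM2l// [X in _ <= _ * X]exchange_big /= mulr_sumr.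
have EB e : [&& e.1 \in D, uniquely_colored c e & c e == i] = (e \in B).
  by rewrite inE.
rewrite (eq_bigl _ _ EB).
apply: ler_sum => e; rewrite inE => /and3P[eD ce /eqP ei].
(* Doubling pairs the sets with and without [e]: the sign is [1] on the former, giving [hits1], and
   [-1] on the latter, giving [hits0]. *)
rewrite mulr_natl -(@sum_toggle R E e) ler_sum// => g _.
rewrite /sgn_in !inE eqxx /= mul1r mulN1r.
have -> : F e (M (e |: g)%SET) (e |: g)%SET = hits1 e g.
  rewrite /F /hits1; congr ((hit e _)%:R); apply/ffunP => j; rewrite !ffunE.
  case: (eqVneq j i) => [->|ji]; rewrite /M ?ffunE; congr (msg _ _);
  apply/setP => x; rewrite !inE.
    case: (eqVneq x e) => [->|xe] /=; first by rewrite eD.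
    case: (eqVneq x.1 e.1) => //= xe1; case: eqP => [cx|]; rewrite ?andbF//.
    by case/eqP: xe; apply: (uniquely_coloredP ce) => //; rewrite cx.
  by case: (eqVneq x e) => //= ->; rewrite ei eq_sym (negPf ji) !andbF.
have -> // : F e (M (g :\ e)%SET) (g :\ e)%SET = hits0 e g.
rewrite /F /hits0; congr ((hit e _)%:R); apply/ffunP => j; rewrite !ffunE.
case: (eqVneq j i) => [->|ji]; rewrite /M ?ffunE; congr (msg _ _);
  apply/setP => x; rewrite !inE.
  case: (eqVneq x e) => [->|xe] /=; first by rewrite eqxx /= andbF.
  case: (eqVneq x.1 e.1) => //= xe1; case: eqP => [cx|]; rewrite ?andbF//.
  by case/eqP: xe; apply: (uniquely_coloredP ce) => //; rewrite cx.
by case: (eqVneq x e) => //= ->; rewrite eqxx /= andbF.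
Qed.

(** Summed over the players, the disjoint colour classes have at most [#|D| * #|J|] slots, the
    messages have total length at most [L], and the constants [1] add up to [k]. *)
Lemma sum_swap_le :
  lambda * \sum_(e | (e.1 \in D) && uniquely_colored c e)
     \sum_g (hits1 e g - hits0 e g) <=
  2 * #|{set E}|%:R * (2 * lambda ^+ 2 * (#|D| * #|J|)%:R + 2 * L + k%:R).
Proof.
rewrite (partition_big c xpredT)//= mulr_sumr.
under eq_bigr do under eq_bigl do rewrite -andbA.
apply: le_trans; first by apply: ler_sum => i _; apply: sum_swap_color_le.
rewrite -mulr_sumr -mulrA ler_pM2l// exchange_big /=.
rewrite (_ : #|{set E}|%:R * ?[x] = \sum_(g : {set E}) ?x); last first.
  by rewrite sumr_const mulr_natl.
apply: ler_sum => g _.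
rewrite !big_split /= -!mulr_sumr sumr_const card_ord lerD2r lerD//; last first.
  by rewrite ler_pM2l// -natr_sum cost_le.
apply: ler_wpM2l; first by rewrite mulr_ge0 ?sqr_ge0.
rewrite -natr_sum ler_nat.
rewrite -cardsT -cardsX -sum1_card (partition_big c xpredT)//=.
apply: leq_sum => i _; rewrite sum1_card subset_leq_card//.
apply/fintype.subsetP => e; rewrite !inE => /and3P[]; case: e => u j eD _ ei.
by rewrite unfold_in /= finset.in_setX eD inE.
Qed.

End Swap.

(** * Averaging over the random set, the planted slot and the partition *)

(** Change of variables [A = D :\ u]. It exposes [u] as a free choice outside [A], while the graph
    without the planted edge depends on [A] only. *)
Lemma sum_pointed_sets (R : realType) (V : finType) (d : nat)
    (f : {set V} -> V -> R) :
  \sum_(D : {set V} | #|D| == d.+1) \sum_(u in D) f (D :\ u)%SET u =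
  \sum_(A : {set V} | #|A| == d) \sum_(u | u \notin A) f A u.
Proof.
rewrite !pair_big_dep /=.
rewrite (reindex_onto (fun p => ((p.2 |: p.1)%SET, p.2))
                      (fun p => ((p.1 :\ p.2)%SET, p.2))) /=; last first.
  by case=> D u /= /andP[_ uD]; rewrite finset.setD1K.
apply: eq_big => [[A u]|[A u] /andP[_ /eqP[-> //]]] /=.
rewrite finset.setU11 andbT cardsU1.
have [uA|uA] /= := boolP (u \in A); last first.
  by rewrite finset.setU1K// eqxx !andbT add1n eqSS.
rewrite andbF; apply/negP => /andP[_ /eqP[AE]].
by move: uA; rewrite -AE !inE eqxx.
Qed.

Section Average.
Variables (R : realType) (V J S : finType) (k d : nat).
Local Notation E := (V * J)%type.
Variables (msg : 'I_k -> {set E} -> seq bool) (col : S -> E -> 'I_k).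
Variable hit : E -> {ffun 'I_k -> seq bool} -> bool.
Variables (L lambda cap : R).
Hypotheses (lambda_gt0 : 0 < lambda) (lambda_le : lambda <= 1 / 2).
Hypotheses (k_gt0 : (0 < k)%N) (J_gt0 : (0 < #|J|)%N) (d_lt : (d < #|V|)%N).
Hypothesis cost_le : forall s g,
  (\sum_i size (messages msg (col s) g i))%:R <= L.
Hypothesis col_indep : forall u j j', j != j' ->
  (k * #|[set s | col s (u, j) == col s (u, j')]| <= #|S|)%N.
Hypothesis hit_le : forall ms, #|[set e | hit e ms]|%:R <= cap * #|J|%:R.

Let hit1 (D : {set V}) e s g : R :=
  (hit e (messages msg (col s) (e |: over (D :\ e.1) g)%SET))%:R.
Let hit0 (D : {set V}) e s g : R :=
  (hit e (messages msg (col s) (over (D :\ e.1) g)))%:R.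
Let nD : R := #|[set D : {set V} | #|D| == d.+1]|%:R.

(** Union bound: each other slot of the same left vertex shares the colour of [e] with probability
    at most [1 / k]. *)
Lemma sum_not_uniquely_colored_le e :
  \sum_s (~~ uniquely_colored (col s) e)%:R <= #|S|%:R * (#|J|%:R / k%:R) :> R.
Proof.
case: e => u j.
apply: (@le_trans _ _ (\sum_(s : S) \sum_(j' | j' != j)
    (col s (u, j') == col s (u, j))%:R)).
  apply: ler_sum => s _.
  have [_|] := boolP (uniquely_colored (col s) (u, j)); first by rewrite sumr_ge0.
  rewrite negb_forall => /existsP[j'] /=.
  rewrite negb_imply => /andP[cj jj'].
  by rewrite (bigD1 j')//= cj lerDl sumr_ge0.
rewrite exchange_big /=.
apply: (@le_trans _ _ (\sum_(j' : J) (#|S|%:R / k%:R))); last first.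
  by rewrite sumr_const -[leLHS]mulr_natr mulrAC -mulrA.
rewrite [leRHS](bigID (predC1 j)) /= ler_wpDr ?sumr_ge0//.
apply: ler_sum => j' jj'; rewrite ler_pdivlMr ?ltr0n//.
have := col_indep u jj'; rewrite -(ler_nat R) natrM mulrC; apply: le_trans.
rewrite ler_pM2r ?ltr0n// -sum1_card natr_sum [leRHS]big_mkcond /=.
by apply: ler_sum => s _; rewrite inE; case: ifP.
Qed.

(** For fixed [A = D :\ u], [s] and [g] the transcript is fixed and hits at most [cap * #|J|] of the
    [(#|V| - d) * #|J|] slots that [e] may be. *)
Lemma sum_hit0_le :
  \sum_(D : {set V} | #|D| == d.+1) \sum_(e | e.1 \in D) \sum_s \sum_g hit0 D e s g
  <= nD * d.+1%:R * #|J|%:R * #|S|%:R * #|{set E}|%:R * (cap / (#|V| - d)%:R).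
Proof.
have nA : nD * d.+1%:R =
    #|[set A : {set V} | #|A| == d]|%:R * (#|V| - d)%:R.
  (* The constant function 1 counts the pointed sets in two ways. *)
  have := @sum_pointed_sets R V d (fun _ _ => 1).
  under eq_bigr => D /eqP cD do rewrite sumr_const cD.
  under [RHS]eq_bigr => A /eqP cA.
    rewrite (eq_bigl (mem (~: A)%SET)) => [|u]; last by rewrite !inE.
    rewrite sumr_const cardsCs finset.setCK cA; over.
  rewrite !sumr_const -!mulrnA => H.
  by rewrite /nD -!natrM mulnC [in RHS]mulnC !cardsE H.
have Vd : 0 < (#|V| - d)%:R :> R by rewrite ltr0n subn_gt0.
rewrite (_ : nD * _ * _ * _ * _ * _ = \sum_(A : {set V} | #|A| == d)
   \sum_(s : S) \sum_(g : {set E}) (cap * #|J|%:R)); last first.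
  rewrite !sumr_const nA cardsE.
  rewrite -3!mulr_natr; field.
  by rewrite gt_eqF.
have pairE (D : {set V}) (F : E -> R) :
    \sum_(e | e.1 \in D) F e = \sum_(u in D) \sum_(j : J) F (u, j).
  by rewrite pair_big /=; apply: eq_big => [[u j]|[u j] //] /=; rewrite andbT.
under eq_bigr do rewrite pairE.
rewrite (sum_pointed_sets d (fun A u => \sum_j \sum_s \sum_g
   (hit (u, j) (messages msg (col s) (over A g)))%:R)).
apply: ler_sum => A _.
rewrite (eq_bigl (mem (~: A)%SET)) => [|u]; last by rewrite !inE.
rewrite -(pairE (~: A)%SET (fun e => \sum_s \sum_g
   (hit e (messages msg (col s) (over A g)))%:R)) exchange_big /=.
apply: ler_sum => s _; rewrite exchange_big /=; apply: ler_sum => g _.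
apply: le_trans (hit_le (messages msg (col s) (over A g))).
rewrite -sum1_card natr_sum [leRHS]big_mkcond [leLHS]big_mkcond /=.
by apply: ler_sum => e _; rewrite [in leRHS]inE; case: ifP => _; case: hit.
Qed.

(** Pointwise, [hit1] is at most 1 if [e] is not uniquely coloured, and [(hit1 - hit0) + hit0]
    otherwise. The three parts are bounded by the union bound, by [sum_swap_le] divided by [lambda],
    and by [sum_hit0_le]. *)
Lemma average_hit1_le :
  \sum_(D : {set V} | #|D| == d.+1) \sum_(e | e.1 \in D) \sum_s \sum_g hit1 D e s g
  <= nD * d.+1%:R * #|J|%:R * #|S|%:R * #|{set E}|%:R *
     (#|J|%:R / k%:R + 4 * lambda +
      (4 * L + 2 * k%:R) / (lambda * d.+1%:R * #|J|%:R) + cap / (#|V| - d)%:R).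
Proof.
apply: (@le_trans _ _ (\sum_(D : {set V} | #|D| == d.+1)
  (\sum_(e | e.1 \in D) \sum_s \sum_(g : {set E}) (~~ uniquely_colored (col s) e)%:R +
   \sum_s \sum_(e | (e.1 \in D) && uniquely_colored (col s) e)
       \sum_g (hit1 D e s g - hit0 D e s g) +
   \sum_(e | e.1 \in D) \sum_s \sum_g hit0 D e s g))).
  apply: ler_sum => D _.
  have -> : \sum_s \sum_(e | (e.1 \in D) && uniquely_colored (col s) e)
      \sum_g (hit1 D e s g - hit0 D e s g) =
      \sum_(e | e.1 \in D) \sum_s if uniquely_colored (col s) e
        then \sum_g (hit1 D e s g - hit0 D e s g) else 0.
    by rewrite exchange_big /=; apply: eq_bigr => s _; rewrite big_mkcondr.
  apply: (@le_trans _ _ (\sum_(e | e.1 \in D)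
    (\sum_s \sum_(g : {set E}) (~~ uniquely_colored (col s) e)%:R +
     (\sum_s if uniquely_colored (col s) e
        then \sum_g (hit1 D e s g - hit0 D e s g) else 0) +
     \sum_s \sum_g hit0 D e s g))); last by rewrite !big_split.
  apply: ler_sum => e _.
  apply: (@le_trans _ _ (\sum_s
    (\sum_(g : {set E}) (~~ uniquely_colored (col s) e)%:R +
     (if uniquely_colored (col s) e
        then \sum_g (hit1 D e s g - hit0 D e s g) else 0) +
     \sum_g hit0 D e s g))); last by rewrite !big_split.
  apply: ler_sum => s _; case: ifP => _ /=.
    by rewrite sumrB big1_eq add0r subrK.
  rewrite addr0 -[leLHS]addr0 lerD ?sumr_ge0//.
  by apply: ler_sum => g _; rewrite /hit1; case: hit.
rewrite !big_split /= !mulrDr lerD ?sum_hit0_le//.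
rewrite -[leRHS]addrA lerD//.
- rewrite (_ : nD * _ * _ * _ * _ * _ = \sum_(D : {set V} | #|D| == d.+1)
     (d.+1%:R * #|J|%:R * #|{set E}|%:R * (#|S|%:R * (#|J|%:R / k%:R)))); last first.
    by rewrite sumr_const -[RHS]mulr_natr /nD cardsE; ring.
  apply: ler_sum => D /eqP cD.
  apply: (@le_trans _ _ (\sum_(e in finset.setX D [set: J])
     #|{set E}|%:R * (#|S|%:R * (#|J|%:R / k%:R)))).
    rewrite [leRHS](eq_bigl (fun e => e.1 \in D)); last first.
      by case=> u j; rewrite finset.in_setX inE andbT.
    apply: ler_sum => e _.
    under eq_bigr do rewrite sumr_const -(mulr_natl (~~ _)%:R).
    rewrite -mulr_sumr ler_wpM2l//; exact: sum_not_uniquely_colored_le.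
  by rewrite sumr_const cardsX cD cardsT -[leLHS]mulr_natl natrM mulrA.
- rewrite -mulrDr (_ : nD * _ * _ * _ * _ * _ = \sum_(D : {set V} | #|D| == d.+1)
    \sum_(s : S) ((2 * #|{set E}|%:R *
     (2 * lambda ^+ 2 * (d.+1 * #|J|)%:R + 2 * L + k%:R)) / lambda)); last first.
    rewrite !sumr_const -2!mulr_natr /nD cardsE natrM; field.
    by rewrite (gt_eqF lambda_gt0) !pnatr_eq0 -lt0n J_gt0 nat1r pnatr_eq0.
  apply: ler_sum => D /eqP cD; apply: ler_sum => s _.
  rewrite ler_pdivlMr// mulrC -cD.
  exact: (sum_swap_le _ _ lambda_gt0 lambda_le (cost_le s)).
Qed.

End Average.

(** * The planted graphs *)

Lemma card_equal_values_le (X : finType) (k : nat) (x y : X) : x != y ->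
  (k * #|[set s : {ffun X -> 'I_k} | s x == s y]| <= #|{ffun X -> 'I_k}|)%N.
Proof.
move=> xy; pose A := [set s : {ffun X -> 'I_k} | s x == s y].
(* Recolouring [x] arbitrarily is injective: [s x] is recovered from [s y]. *)
pose f (p : {ffun X -> 'I_k} * 'I_k) : {ffun X -> 'I_k} :=
  [ffun z => if z == x then p.2 else p.1 z].
have f_inj : {in finset.setX A [set: 'I_k] &, injective f}.
  move=> [s a] [t b]; rewrite !finset.in_setX !inE !andbT => /eqP sxy /eqP txy st.
  have fE z : f (s, a) z = f (t, b) z by rewrite st.
  have ab : a = b by have := fE x; rewrite !ffunE eqxx.
  congr (_, _) => //; apply/ffunP => z; have := fE z; rewrite !ffunE /=.
  case: eqP => // -> _; have := fE y.
  by rewrite !ffunE /= eq_sym (negPf xy) sxy txy.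
have := max_card (mem (f @: finset.setX A [set: 'I_k])).
by rewrite card_in_imset// cardsX cardsT card_ord mulnC.
Qed.

Section Edges.
Variables (n h s : nat) (hn : (h + h + s <= n)%N).
Implicit Types (u : 'I_h) (j : 'I_s) (e : 'I_h * 'I_s).

Lemma left_subproof u : (u < n)%N.
Proof. by have := ltn_ord u; lia. Qed.

Lemma right_subproof u j : (h + u + j < n)%N.
Proof. by have := ltn_ord u; have := ltn_ord j; lia. Qed.

Definition lvertex u : 'I_n := Ordinal (left_subproof u).
Definition rvertex e : 'I_n := Ordinal (right_subproof e.1 e.2).

Lemma ends_subproof e : #|[set lvertex e.1; rvertex e]| == 2.
Proof.
rewrite cards2; case: (eqVneq (lvertex _)) => // /(congr1 val) /=.
by have := ltn_ord e.1; lia.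
Qed.

Definition ends e : edge n := Sub [set lvertex e.1; rvertex e] (ends_subproof e).

Lemma mem_ends e v :
  (v \in val (ends e)) = (v == lvertex e.1) || (v == rvertex e).
Proof. by rewrite SubK !inE. Qed.

(** Slots of equal index form a matching: the left and right blocks are disjoint, and a right vertex
    [h + u + j] with known [j] determines [u]. *)
Lemma mem_ends_inj e e' v :
  v \in val (ends e) -> v \in val (ends e') -> e.2 = e'.2 -> e = e'.
Proof.
case: e e' => [u j] [u' j']; rewrite !mem_ends /= => + + jj; rewrite -{}jj.
move=> ve ve'; congr (_, _); apply/val_inj; move: ve ve' => /=.
have := ltn_ord u; have := ltn_ord u'.
by move=> ? ? /orP[/eqP->|/eqP->] /orP[] /eqP /(congr1 val) /=; lia.
Qed.

Lemma ends_inj : injective ends.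
Proof.
move=> [u j] [u' j'] E; apply: (@mem_ends_inj _ _ (lvertex u)).
- by rewrite mem_ends eqxx.
- by rewrite -E mem_ends eqxx.
have : rvertex (u, j) \in val (ends (u', j')) by rewrite -E mem_ends eqxx orbT.
have : lvertex u \in val (ends (u', j')) by rewrite -E mem_ends eqxx.
rewrite !mem_ends => /orP[] /eqP /(congr1 val) /= H1
  /orP[] /eqP /(congr1 val) /= H2; apply: val_inj => /=.
all: by have := ltn_ord u; have := ltn_ord u'; lia.
Qed.

(** Each vertex lies on at most one slot of each of the [s] indices. *)
Lemma card_covered_le (C : {set 'I_n}) :
  (#|[set e | [exists v in val (ends e), v \in C]]| <= #|C| * s)%N.
Proof.
apply: (@leq_trans (\sum_(v in C) #|[set e | v \in val (ends e)]|)); last first.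
  rewrite -sum_nat_const; apply: leq_sum => v _.
  rewrite -[leqRHS](card_ord s); apply: (@leq_card_in _ _ snd) => e e'.
  by rewrite !inE -!mem_ends; apply: mem_ends_inj.
apply: (@leq_trans #|(\bigcup_(v in C) [set e | v \in val (ends e)])%SET|).
  apply: subset_leq_card; apply/fintype.subsetP => e; rewrite finset.in_set.
  move=> /existsP[v /andP[ve vC]]; apply/finset.bigcupP; exists v => //.
  by rewrite inE.
elim/big_rec2: _ => [|v m A _ IH]; first by rewrite cards0.
by rewrite (leq_trans (leq_card_setU _ _))// leq_add2l.
Qed.

Lemma VC_le (G : graph n) (D : {set 'I_h}) :
  (forall x, x \in G -> exists2 e, x = ends e & e.1 \in D) -> (VC G <= #|D|)%N.
Proof.
move=> GD; apply: (@leq_trans #|lvertex @: D|); last exact: leq_imset_card.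
have cov : vertex_cover G (lvertex @: D).
  apply/forall_inP => x /GD[e -> eD]; apply/existsP; exists (lvertex e.1).
  by rewrite mem_ends eqxx imset_f.
(* [arg_minnP] also asks that its default, the set of all vertices, be a cover. *)
rewrite /VC; case: arg_minnP => [|C _ Cmin]; last exact: Cmin.
apply/forall_inP => x /GD[e -> eD]; apply/existsP; exists (lvertex e.1).
by rewrite mem_ends eqxx inE.
Qed.

End Edges.

Section Planted.
Variables (R : realType) (n k h s d : nat) (hn : (h + h + s <= n)%N).
Variables (alpha L lambda : R) (Pi : protocol R n k) (w : coins Pi).
Hypotheses (alpha_ge0 : 0 <= alpha).
Hypotheses (lambda_gt0 : 0 < lambda) (lambda_le : lambda <= 1 / 2).
Hypotheses (k_gt0 : (0 < k)%N) (s_gt0 : (0 < s)%N) (d_lt : (d < h)%N).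
Hypothesis cost_le : forall G sigma,
  (\sum_i size (transcript w G sigma i))%:R <= L.
Local Notation E := ('I_h * 'I_s)%type.

Definition planted (D : {set 'I_h}) (e : E) (g : {set E}) : graph n :=
  ends hn @: (e |: over (D :\ e.1) g)%SET.

Let msg i (T : {set E}) := message i w (ends hn @: T).
Let col (sigma : assignment n k) (e : E) := sigma (ends hn e).

(** Links the protocol to the abstract model on slots, the colour of a slot being the player of its
    edge. *)
Lemma transcript_imset (T : {set E}) sigma :
  transcript w (ends hn @: T) sigma = messages msg (col sigma) T.
Proof.
apply/ffunP => i; rewrite !ffunE /msg; congr message; apply/setP => x.
rewrite !inE; apply/andP/imsetP => [[/imsetP[e eT ->] ei]|[e]].
  by exists e; rewrite ?inE ?eT.
by rewrite inE => /andP[eT ei] ->; rewrite imset_f.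
Qed.

(** For fixed coins, a correct answer meets [e] and has at most [alpha * VC <= alpha * d.+1]
    vertices, since [D] is a cover. Hence success implies a hit, with [cap = alpha * d.+1]. *)
Lemma planted_success_le :
  \sum_(D : {set 'I_h} | #|D| == d.+1) \sum_(e | e.1 \in D)
    \sum_(sigma : assignment n k) \sum_(g : {set E})
      (approx_vertex_cover alpha (planted D e g)
         (answer w (planted D e g) sigma))%:R
  <= #|[set D : {set 'I_h} | #|D| == d.+1]|%:R * d.+1%:R * s%:R *
     #|{: assignment n k}|%:R * #|{set E}|%:R *
     (s%:R / k%:R + 4 * lambda +
      (4 * L + 2 * k%:R) / (lambda * d.+1%:R * s%:R) +
      alpha * d.+1%:R / (h - d)%:R) :> R.
Proof.
(* The size test is part of [hit], so that [hit_le] holds for every transcript, whether or not the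
   answer is correct. *)
pose hit (e : E) ms : bool := let C := output w ms in
  (#|C|%:R <= alpha * d.+1%:R) && [exists v in val (ends hn e), v \in C].
have hit_le ms : #|[set e | hit e ms]|%:R <= (alpha * d.+1%:R) * #|'I_s|%:R :> R.
  rewrite card_ord /hit /=.
  have [Cd|_] := boolP (#|output w ms|%:R <= _); last first.
    by rewrite eq_card0 ?mulr_ge0// => e; rewrite inE.
  apply: (@le_trans _ _ (#|output w ms| * s)%:R); last by rewrite natrM ler_wpM2r.
  by rewrite ler_nat card_covered_le.
have cost g sigma : (\sum_i size (messages msg (col sigma) g i))%:R <= L.
  by rewrite -transcript_imset.
have indep u (j j' : 'I_s) : j != j' ->
    (k * #|[set sigma | col sigma (u, j) == col sigma (u, j')]|
      <= #|{: assignment n k}|)%N.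
  move=> jj'; apply: card_equal_values_le; apply: contra jj'.
  by move=> /eqP /ends_inj [->].
have := average_hit1_le lambda_gt0 lambda_le k_gt0 _ _
  (fun sigma g => cost g sigma) indep hit_le (d := d).
rewrite !card_ord => /(_ s_gt0 d_lt); apply: le_trans.
apply: ler_sum => D /eqP cD; apply: ler_sum => e eD.
apply: ler_sum => sigma _; apply: ler_sum => g _.
rewrite ler_nat -transcript_imset -/(planted D e g) -/(answer w _ sigma).
rewrite /approx_vertex_cover; case: andP => //= -[cov size_le].
rewrite /hit /= -/(answer w _ sigma).
have -> /= : #|answer w (planted D e g) sigma|%:R <= alpha * d.+1%:R.
  rewrite (le_trans size_le)// ler_wpM2l// ler_nat -cD (@VC_le _ _ _ hn)// => x.
  move=> /imsetP[e' + ->]; rewrite !inE => /orP[/eqP ->|/andP[_ /andP[_ e'D]]].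
    by exists e.
  by exists e'.
have := forall_inP cov (ends hn e); rewrite imset_f ?setU11// => /(_ isT) H.
by rewrite H.
Qed.

End Planted.

(** * Public coins *)

Local Open Scope classical_set_scope.

(** Probabilities are integrals of indicators, and the sum of the indicators is at most [t]
    pointwise. This reduces public coins to fixed ones. *)
Lemma sum_probability_le (R : realType) (dT : measure_display)
    (T : measurableType dT) (P : probability T R) (I : finType) (Q : pred I)
    (A : I -> T -> bool) (t : R) :
    (forall i, measurable [set w | A i w]) ->
    (forall w, \sum_(i | Q i) (A i w)%:R <= t) ->
  \sum_(i | Q i) fine (P [set w | A i w]) <= t.
Proof.
move=> mA At; rewrite -lee_fin -sumEFin.
under eq_bigr => i _ do rewrite fineK ?fin_num_measure//.
have PE i : P [set w | A i w] = (\int[P]_x (\1_[set w | A i w] x)%:E)%E.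
  by rewrite integral_indic// setIT.
under eq_bigr do rewrite PE.
rewrite -big_filter -ge0_integral_sum//; last first.
  by move=> i; apply/measurable_EFinP; exact: measurable_indic.
have -> : t%:E = (\int[P]_(x in setT) (cst t%:E x))%E.
  rewrite integral_cst// [X in (_ * X)%E](_ : _ = 1%E) ?mule1//.
  exact: probability_setT.
have tE w : (\sum_(k <- [seq i <- index_enum I | Q i]) (\1_[set w | A k w] w)%:E
    <= t%:E)%E.
  rewrite big_filter sumEFin lee_fin; apply: le_trans (At w).
  apply: ler_sum => i _; rewrite indicE mem_setE.
  by rewrite /in_mem /=; case: (A i w).
apply: ge0_le_integral => //=.
- by move=> w _; apply: sume_ge0 => i _; rewrite lee_fin.
- by apply: emeasurable_sum => i; apply/measurable_EFinP; exact: measurable_indic.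
Qed.

Section Measurable.
Variables (R : realType) (n k : nat) (Pi : protocol R n k).

(** There are countably many pairs of a transcript and an answer, and each pair is taken on a
    measurable set of coins. *)
Lemma measurable_answer (Q : {set 'I_n} -> bool) G sigma :
  measurable [set w : coins Pi | Q (answer w G sigma)].
Proof.
have -> : [set w : coins Pi | Q (answer w G sigma)] =
    \bigcup_(p : {ffun 'I_k -> seq bool} * {set 'I_n})
      ([set w | [forall i, message i w (part G sigma i) == p.1 i]] `&`
       [set w | output w p.1 = p.2] `&` [set _ | Q p.2]).
  apply/seteqP; split=> w /=.
    move=> Qw; exists (transcript w G sigma, answer w G sigma) => //=.
    by split=> //; split=> //; apply/forallP => i; rewrite ffunE.
  move=> [[ms C] _ /= [[/forallP msE CE] QC]]; rewrite /answer.
  suff -> : transcript w G sigma = ms by rewrite CE.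
  by apply/ffunP => i; rewrite ffunE; apply/eqP/msE.
apply: countable_bigcupT_measurable => [|[ms C]]; first exact: countableP.
apply: measurableI; last first.
  rewrite /=; case: (Q C).
    by rewrite [X in measurable X](_ : _ = setT)//; apply/seteqP; split.
  by rewrite [X in measurable X](_ : _ = set0)//; apply/seteqP; split.
apply: measurableI; last exact: measurable_output.
rewrite [X in measurable X](_ : _ =
    \bigcap_(i in [set: 'I_k]) [set w | message i w (part G sigma i) = ms i]).
  apply: fin_bigcap_measurable => [|i _]; first exact: finite_finset.
  exact: measurable_message.
apply/seteqP; split=> w /= => [/forallP msE i _|msE]; first exact/eqP/msE.
by apply/forallP => i; apply/eqP/msE.
Qed.

End Measurable.

Section LowerBound.
Variables (R : realType) (n k h s d : nat) (hn : (h + h + s <= n)%N).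
Variables (alpha L lambda : R) (Pi : protocol R n k).
Hypotheses (alpha_ge0 : 0 <= alpha).
Hypotheses (lambda_gt0 : 0 < lambda) (lambda_le : lambda <= 1 / 2).
Hypotheses (k_gt0 : (0 < k)%N) (s_gt0 : (0 < s)%N) (d_lt : (d < h)%N).
Hypothesis cost_le : forall (w : coins Pi) G sigma,
  (\sum_i size (transcript w G sigma i))%:R <= L.
Local Notation E := ('I_h * 'I_s)%type.

(** Averaging argument: success [p] on every graph gives success [p] on average over planted graphs,
    and for each value of the coins that average is bounded. *)
Lemma solves_vertex_cover_le p : solves_vertex_cover Pi alpha p ->
  p <= s%:R / k%:R + 4 * lambda +
      (4 * L + 2 * k%:R) / (lambda * d.+1%:R * s%:R) +
      alpha * d.+1%:R / (h - d)%:R.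
Proof.
set theta := (X in _ <= X) => solves.
pose Q (x : ({set 'I_h} * E) * {set E}) := (#|x.1.1| == d.+1) && (x.1.2.1 \in x.1.1).
pose G (x : ({set 'I_h} * E) * {set E}) := planted hn x.1.1 x.1.2 x.2.
pose NS : R := #|{: assignment n k}|%:R.
have sumQ F : \sum_(x | Q x) F x = \sum_(D : {set 'I_h} | #|D| == d.+1)
    \sum_(e | e.1 \in D) \sum_(g : {set E}) F ((D, e), g) :> R.
  rewrite pair_big_dep pair_big /=.
  by apply: eq_big => [[[D e] g]|[[D e] g] _] //=; rewrite andbT.
have cardQ : \sum_(x | Q x) 1 = #|[set D : {set 'I_h} | #|D| == d.+1]%SET|%:R *
    d.+1%:R * s%:R * #|{set E}|%:R :> R.
  rewrite sumQ.
  transitivity (\sum_(D : {set 'I_h} | #|D| == d.+1)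
    (d.+1%:R * s%:R * #|{set E}|%:R) : R); last first.
    by rewrite sumr_const -[LHS]mulr_natl cardsE; ring.
  apply: eq_bigr => D /eqP cD.
  rewrite (eq_bigl (mem (finset.setX D [set: 'I_s]%SET))); last first.
    by case=> u j; rewrite inE /= finset.in_setX inE andbT.
  under eq_bigr do rewrite sumr_const.
  by rewrite sumr_const cardsX cD cardsT card_ord -[LHS]mulr_natl natrM.
have cardQ_gt0 : 0 < \sum_(x | Q x) (1 : R).
  rewrite cardQ mulr_gt0//; last first.
    by rewrite ltr0n; apply/card_gt0P; exists finset.set0.
  by rewrite !mulr_gt0 ?ltr0n// card_draws card_ord bin_gt0.
have NS_gt0 : 0 < NS.
  rewrite ltr0n; apply/card_gt0P; exists [ffun=> Ordinal k_gt0].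
  by rewrite inE.
(* Multiplying by the numbers of assignments and of planted inputs replaces averages by sums. *)
rewrite -(ler_pM2l NS_gt0) -(ler_pM2l cardQ_gt0).
apply: (@le_trans _ _ (\sum_(y : ({set 'I_h} * E) * {set E} * assignment n k | Q y.1)
   fine (coins_prob Pi
     [set w | approx_vertex_cover alpha (G y.1) (answer w (G y.1) y.2)]))).
  rewrite mulr_suml.
  rewrite (_ : \sum_(y | Q y.1) _ = \sum_(x | Q x) \sum_(sigma : assignment n k)
     fine (coins_prob Pi
     [set w | approx_vertex_cover alpha (G x) (answer w (G x) sigma)])); last first.
    by rewrite pair_big /=; apply: eq_bigl => y; rewrite andbT.
  apply: ler_sum => x _; rewrite mul1r mulrC -ler_pdivlMr//; exact: solves.
apply: sum_probability_le => [y|w]; first exact: measurable_answer.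
have := planted_success_le hn alpha_ge0 lambda_gt0 lambda_le k_gt0 s_gt0 d_lt
  (cost_le w).
rewrite -/theta cardQ -/NS => H.
apply: le_trans (le_trans H _); last first.
  by rewrite le_eqVlt; apply/orP; left; apply/eqP; ring.
rewrite le_eqVlt; apply/orP; left; apply/eqP.
transitivity (\sum_(x | Q x) \sum_(sigma : assignment n k)
  (approx_vertex_cover alpha (G x) (answer w (G x) sigma))%:R : R).
  by rewrite pair_big /=; apply: eq_bigl => y; rewrite andbT.
rewrite sumQ; apply: eq_bigr => D _; apply: eq_bigr => e _.
by rewrite exchange_big.
Qed.

End LowerBound.

(** * Choice of the parameters *)

(** Here [D] stands for [d.+1], [H] for [h - d], and [lambda = 1 / 50]. The four terms are at most
    [1/2], [2/25], [1/10] and [1/5], in total [0.88]. *)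
Lemma planted_error_lt (R : realFieldType) (N K a S D H : R) :
    1 <= a -> 400 * a <= K -> 400 * (a * K) <= N -> 2 * S <= K ->
    K <= 2 * S + 1 -> N <= 20 * a * D -> 20 * a * (D - 1) <= N ->
    28 * N <= 100 * H ->
  S / K + 4 * (1 / 50) +
    (4 * (1 / (400 * 500) * (N * K / a)) + 2 * K) / (1 / 50 * D * S) + a * D / H
  < 9 / 10.
Proof.
move=> a1 aK aKN SK KS ND DN NH.
have K400 : 400 <= K by lra.
have aK400 : a * 400 <= a * K by rewrite ler_wpM2l//; lra.
have [x Nx] : exists x, N = x * a by exists (N / a); rewrite divfK// gt_eqF//; lra.
have xK : 400 * K <= x.
  by rewrite -(ler_pM2r (lt_le_trans ltr01 a1)); lra.
have xD : x <= 20 * D by rewrite -(ler_pM2r (lt_le_trans ltr01 a1)); lra.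
have H1 : S / K <= 1 / 2 by rewrite ler_pdivrMr; lra.
have H4 : a * D / H <= 1 / 5 by rewrite ler_pdivrMr; lra.
have DS : (x / 20) * (49 / 100 * K) <= D * S by apply: ler_pM; lra.
have Kx : (400 * 400) * K <= x * K by rewrite ler_wpM2r//; lra.
have H3 : (4 * (1 / (400 * 500) * (N * K / a)) + 2 * K) / (1 / 50 * D * S) <= 1 / 10.
  have -> : N * K / a = x * K by rewrite Nx mulrAC mulfK// gt_eqF//; lra.
  rewrite ler_pdivrMr; first by lra.
  by rewrite !mulr_gt0//; lra.
lra.
Qed.

Lemma vertex_cover_cost_ge (R : realType) (n k : nat) (alpha : R)
    (Pi : protocol R n k) :
    1 <= alpha -> 400 * alpha <= k%:R -> 400 * (alpha * k%:R) <= n%:R ->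
    solves_vertex_cover Pi alpha (9 / 10) ->
  ((1 / (400 * 500) * (n%:R * k%:R / alpha))%:E <= communication_cost Pi)%E.
Proof.
move=> a1 aK aKN solves; rewrite leNgt; apply/negP => cost_lt.
have a0 : 0 < alpha by lra.
have K400 : 400 <= k%:R :> R by lra.
have kn : 400 * k%:R <= n%:R :> R.
  by have := ler_wpM2r (ler0n R k) a1; lra.
have k2 : (2 <= k)%N by rewrite -(ler_nat R); lra.
have nk : (9 * k <= n)%N by rewrite -(ler_nat R) natrM; lra.
(* Half of [k] slots per vertex keep the collision term at most [1/2]; [d] makes [alpha * d.+1]
   about [n / 20], small against [h - d]. *)
pose s := (k %/ 2)%N; pose h := (n %/ 3)%N.
pose d := Num.truncn (n%:R / (20 * alpha) : R).
have hn : (h + h + s <= n)%N by rewrite /h /s; clear - nk k2; lia.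
have x0 : 0 <= n%:R / (20 * alpha) by rewrite divr_ge0//; lra.
have /andP[] := truncn_itv x0; rewrite -/d.
rewrite ler_pdivlMr ?ltr_pdivrMr ?mulr_gt0// => dn nd.
have dn' : 20 * d%:R <= n%:R :> R.
  by have := ler_wpM2l (ler0n R d) a1; lra.
have h3 : n%:R <= 3 * h%:R + 2 :> R.
  by rewrite -natrM -natrD ler_nat /h; clear; lia.
have N400 : (400 * 400) <= n%:R :> R by lra.
have dh : (d < h)%N by rewrite -(ltr_nat R); lra.
have L_le (w : coins Pi) G sigma : (\sum_i size (transcript w G sigma i))%:R
    <= 1 / (400 * 500) * (n%:R * k%:R / alpha).
  rewrite -lee_fin; apply: le_trans (ltW cost_lt).
  by apply: ereal_sup_ubound; exists w, G, sigma.
have s_gt0 : (0 < s)%N by rewrite /s; clear - k2; lia.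
have l0 : 0 < 1 / 50 :> R by rewrite divr_gt0.
have l2 : 1 / 50 <= 1 / 2 :> R by rewrite !mul1r lef_pV2 ?posrE// ler_nat.
have := solves_vertex_cover_le hn (ltW a0) l0 l2 (ltnW k2) s_gt0 dh L_le solves.
apply/negP; rewrite -ltNge; apply: planted_error_lt => //.
- by rewrite -natrM ler_nat /s; clear; lia.
- by rewrite -natrM natr1 ler_nat /s; clear; lia.
- by rewrite mulrC ltW.
- by rewrite -(natr1 d) addrK mulrC.
- by rewrite natrB ?(ltnW dh)//; lra.
Qed.

Theorem theorem6 (R : realType) (k : nat -> nat) (alpha : nat -> R)
    (alpha_Omega : alpha \is 'Omega_\oo(fun n : nat => ln (n%:R : R)))
    (alpha_o : alpha =o_\oo
       (fun n : nat => Num.min (n%:R / (k n)%:R) ((k n)%:R : R))) :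
  exists2 c : R, 0 < c &
    \forall n \near \oo, forall Pi : protocol R n (k n),
      solves_vertex_cover Pi (alpha n) (9 / 10) ->
      ((c * (n%:R * (k n)%:R / alpha n))%:E <= communication_cost Pi)%E.
Proof.
have c_gt0 : 0 < 1 / (400 * 500) :> R by rewrite divr_gt0 ?mulr_gt0 ?ltr0n ?ltr01.
exists (1 / (400 * 500)) => //.
move: alpha_Omega; rewrite qualifE /= => /asboolP[K K0 KO].
(* The constant [1 / 400] yields both [400 * alpha <= k] and [400 * alpha <= n / k]. *)
have /eqoP/(_ (1 / 400) _) oK := alpha_o.
have {}oK := oK ltac:(by rewrite divr_gt0 ?ltr0n ?ltr01).
near=> n => Pi solves.
(* Holds once [n >= exp(K^-1)]. *)
have lnK : 1 <= K * `|ln (n%:R : R)|.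
  rewrite -ler_pdivrMl// mulr1 ger0_norm.
    rewrite -[leLHS]expRK ler_ln ?posrE ?expR_gt0//; last first.
      by apply: lt_le_trans (expR_gt0 K^-1) _; near: n; exact: nbhs_infty_ger.
    by near: n; exact: nbhs_infty_ger.
  by rewrite ln_ge0//; near: n; exact: nbhs_infty_ger.
have a_ge1 : 1 <= `|alpha n|.
  by apply: le_trans lnK _; near: n.
have a_le : `|alpha n| <= 1 / 400 * `|Num.min (n%:R / (k n)%:R) ((k n)%:R : R)|.
  by near: n.
move: a_le; rewrite (ger0_norm (_ : 0 <= Num.min _ _)); last first.
  by rewrite le_min divr_ge0// ler0n.
move=> a_le.
have ak : 400 * `|alpha n| <= (k n)%:R.
  have : Num.min (n%:R / (k n)%:R) ((k n)%:R : R) <= (k n)%:R.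
    by rewrite ge_min lexx orbT.
  lra.
have ank : 400 * `|alpha n| <= n%:R / (k n)%:R.
  have : Num.min (n%:R / (k n)%:R) ((k n)%:R : R) <= n%:R / (k n)%:R.
    by rewrite ge_min lexx.
  lra.
have k_gt0 : 0 < (k n)%:R :> R by lra.
(* The asymptotic bounds control only [|alpha n|]. If [alpha n <= 0], the claimed bound is
   nonpositive. *)
have [a_gt0|a_le0] := ltP 0 (alpha n).
  rewrite (gtr0_norm a_gt0) in a_ge1 ak ank.
  apply: vertex_cover_cost_ge => //.
  by rewrite mulrA -ler_pdivlMr.
(* A point of the coins, which exists as their total mass is 1, keeps the supremum from being over
   an empty set. *)
have [w] : exists w : coins Pi, True.
  apply: contrapT => /forallNP no_w.
  have := @probability_setT _ _ _ (coins_prob Pi).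
  rewrite (_ : setT = set0) ?measure0; last by rewrite -subset0 => w; have := no_w w.
  by move=> /eqP; rewrite eq_sym onee_eq0.
rewrite ltr0n in k_gt0.
move=> _; apply: (@le_trans _ _ 0%E).
  rewrite lee_fin mulr_ge0_le0 ?(ltW c_gt0)//.
  by rewrite mulr_ge0_le0 ?mulr_ge0 ?ler0n ?invr_le0.
apply: (@le_trans _ _ ((\sum_(i < k n) size (transcript w finset.set0
    [ffun=> Ordinal k_gt0] i))%N%:R : R)%:E).
  by rewrite lee_fin ler0n.
by apply: ereal_sup_ubound; exists w, finset.set0, [ffun=> Ordinal k_gt0].
Unshelve. all: by end_near.
Qed.
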